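(* Let $X$ and $Y$ be finite-dimensional Banach spaces over $\mathbb{K}\in\{\mathbb{R},\mathbb{C}\}$, let $G \in L(X,Y)$ with $\|G\| = 1$, and assume $\|\cdot\|_G$ is a norm on $L(X,Y)$. Define $\widetilde{C}: = \{ \psi_{x,y^*} : (x,y^* ) \in S_X \times S_{Y^*},\ \|Gx\| = 1 \}$. Then the closed unit ball of the dual of $(L(X,Y),\|\cdot\|_G)$ is $B_{(L(X,Y),\|\cdot\|_G)^*} = \operatorname{co}(\widetilde{C})$, the convex hull of $\widetilde{C}$.
   Context: $S_X$ is the unit sphere of $X$, $Y^*$ the dual of $Y$. For $x\in X$, $y^*\in Y^*$, $\psi_{x,y^*}(S)=y^*(Sx)$ for $S\in L(X,Y)$. The $G$-norm is $\|T\|_G := \inf_{\delta>0}\sup\{\|Tx\|: x\in S_X,\ \|Gx\|>1-\delta\}$. *)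

(* Defs.v *)
From HB Require Import structures.
From mathcomp Require Import all_boot all_order all_algebra.
From mathcomp Require Import all_classical all_reals all_analysis.
From mathcomp Require Export complex.
Export numFieldNormedType.Exports.
Set Implicit Arguments. Unset Strict Implicit. Unset Printing Implicit Defensive.
Import Order.TTheory GRing.Theory Num.Theory.
Local Open Scope classical_set_scope.
Local Open Scope ring_scope.

Section Defs.
Variable K : numFieldType.

Definition findim (V : lmodType K) : Prop :=
  exists (n : nat) (e : 'I_n -> V),
    forall v : V, exists c : 'I_n -> K, v = \sum_(i < n) c i *: e i.

Definition unit_sphere (V : normedModType K) : set V := [set x | `|x| = 1].

Definition opnorm_eq1 (V W : normedModType K) (f : V -> W) : Prop :=
  supremums [set `|f x| | x in [set x : V | `|x| <= 1]] 1.

Definition dual_sphere (V : normedModType K) (f : V -> K) : Prop :=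
  supremums [set `|f x| | x in [set x : V | `|x| <= 1]] 1.

Definition Gnorm_set (X Y : normedModType K) (G T : X -> Y) (d : K) : set K :=
  [set `|T x| | x in [set x : X | `|x| = 1 /\ 1 - d < `|G x|]].

Definition Gnorm (X Y : normedModType K) (G T : X -> Y) : K :=
  infimum 0 [set supremum 0 (Gnorm_set G T d) | d in [set d : K | 0 < d]].

Definition Gnorm_is_norm (X Y : normedModType K) (G : X -> Y) : Prop :=
  [/\ forall T : X -> Y, linear T -> 0 <= Gnorm G T,
      forall T : X -> Y, linear T -> Gnorm G T = 0 -> forall x, T x = 0,
      forall (a : K) (T : X -> Y), linear T ->
        Gnorm G (fun x => a *: T x) = `|a| * Gnorm G T &
      forall S T : X -> Y, linear S -> linear T ->
        Gnorm G (fun x => S x + T x) <= Gnorm G S + Gnorm G T].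

(* Phi is a linear functional on L(X,Y) (functionals are identified by their
   values on linear maps). *)
Definition lin_functional (X Y : normedModType K) (Phi : (X -> Y) -> K) : Prop :=
  forall (a : K) (S T : X -> Y), linear S -> linear T ->
    Phi (fun x => a *: S x + T x) = a * Phi S + Phi T.

Definition Gdual_ball (X Y : normedModType K) (G : X -> Y) : set ((X -> Y) -> K) :=
  [set Phi | lin_functional Phi /\
     forall T : X -> Y, linear T -> Gnorm G T <= 1 -> `|Phi T| <= 1].

Definition psi (X Y : normedModType K) (x : X) (ys : Y -> K) : (X -> Y) -> K :=
  fun S => ys (S x).

Definition Ctilde (X Y : normedModType K) (G : X -> Y) (Phi : (X -> Y) -> K) : Prop :=
  exists (x : X) (ys : Y -> K),
    [/\ `|x| = 1, linear (ys : Y -> K^o), dual_sphere ys, `|G x| = 1 &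
        forall T : X -> Y, linear T -> Phi T = psi x ys T].

Definition co_Ctilde (X Y : normedModType K) (G : X -> Y) : set ((X -> Y) -> K) :=
  [set Phi | exists (n : nat) (l : 'I_n -> K) (c : 'I_n -> (X -> Y) -> K),
     [/\ forall i, 0 <= l i, \sum_(i < n) l i = 1, forall i, Ctilde G (c i) &
         forall T : X -> Y, linear T -> Phi T = \sum_(i < n) l i * c i T]].

End Defs.

(* Main.v *)
Require Import Defs.
From HB Require Import structures.
From mathcomp Require Import all_boot all_order all_algebra.
From mathcomp Require Import all_classical all_reals all_analysis.
From mathcomp Require Import complex.
From mathcomp Require Import ring lra.
Import Order.TTheory GRing.Theory Num.Theory.
Import numFieldNormedType.Exports.
Set Implicit Arguments. Unset Strict Implicit. Unset Printing Implicit Defensive.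
Local Open Scope classical_set_scope.
Local Open Scope ring_scope.

(* By compactness of the unit sphere of X, the G-norm of T is the maximum of
   |T x| over the x with |x| = |G x| = 1, hence, by Hahn-Banach, the maximum of
   Re psi_{x,y*}(T) over the set C of the psi_{x,y*} with y* a norming
   functional.  In the real coordinates given by a finite real spanning family
   of L(X,Y), C is compact, and a functional Phi of the dual ball satisfies
   Re Phi(T) <= max_{c in C} Re c(T) for all T.  The convex hull of C is compact
   by Caratheodory's theorem, and the nearest-point argument shows that it
   contains Phi. *)

(** * Convex hulls of compact sets in R^m *)

(** The hull in the statement carries no closure, so approximation is not allowed anywhere: the
    G-norm has to be attained at a point where |G x| is exactly 1, and the hull of C has to be
    closed. Bounding the number of points is what achieves the latter, since it makes the hull one
    continuous image of one compact set. Only real parts are separated. Nothing is lost, because Re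
    Phi(z T) for all scalars z determines Phi(T); this lets a single argument serve both scalar
    fields. The norms of X and Y are used only as continuous functions of real parameters, so no
    topology on X or Y has to be compared with that of R^n, and spanning families may be redundant.
    The converse inclusion rests on the same maximum formula for the G-norm. *)

Section ConvexHull.
Context {R : realType} {m : nat}.
Implicit Types (A : set 'rV[R]_m) (p q : 'rV[R]_m).

(** With [n] fixed, this is the image of a single parameter space. Repeated points and zero weights
    are allowed, so it collects the combinations of at most [n] points. *)
Definition hull A (n : nat) : set 'rV[R]_m :=
  [set p | exists (l : 'I_n -> R) (c : 'I_n -> 'rV[R]_m),
     [/\ forall i, 0 <= l i, \sum_i l i = 1, forall i, A (c i) &
         p = \sum_i l i *: c i]].

Lemma hull_join A n q c t : hull A n q -> A c -> 0 <= t <= 1 ->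
  hull A n.+1 (t *: c + (1 - t) *: q).
Proof.
move=> [l [d [l0 l1 Ad ->]]] Ac /andP[t0 t1].
exists (fun i => if unlift ord0 i is Some j then (1 - t) * l j else t).
exists (fun i => if unlift ord0 i is Some j then d j else c); split.
- by move=> i; case: unliftP => [j _|//]; rewrite mulr_ge0 ?subr_ge0.
- rewrite big_ord_recl unlift_none.
  under eq_bigr => i _ do rewrite liftK.
  by rewrite -mulr_sumr l1 mulr1 addrC subrK.
- by move=> i; case: unliftP.
- rewrite big_ord_recl unlift_none.
  under [in RHS]eq_bigr => i _ do rewrite liftK -scalerA.
  by rewrite scaler_sumr.
Qed.

(* An affine dependency among more than m + 1 points lets one shift the weights
   until one of them vanishes. *)
Lemma hull_reduce A n p : (m < n)%N -> hull A n.+1 p -> hull A n p.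
Proof.
move=> mn [l [c [l0 l1 Ac ->]]].
(* The appended 1 makes a left kernel vector an affine dependency: both the combination of the
   points and the sum of the coefficients vanish. *)
pose B : 'M[R]_(n.+1, m + 1) := \matrix_i row_mx (c i) (const_mx 1).
have /rowV0Pn[mu /sub_kermxP muB mu0] : kermx B != 0.
  rewrite kermx_eq0 /row_free; apply/negP => /eqP rB.
  by have := rank_leq_col B; rewrite rB addn1 ltnS leqNgt mn.
move: muB; rewrite mulmx_sum_row => muB.
have muc : \sum_i mu 0 i *: c i = 0.
  have := congr1 lsubmx muB; rewrite linear0 linear_sum => {2}<-.
  by apply: eq_bigr => i _; rewrite linearZ /= rowK row_mxKl.
have mu1 : \sum_i mu 0 i = 0.
  have := congr1 (fun v => rsubmx v 0 0) muB.
  rewrite linear0 linear_sum summxE !mxE => {2}<-.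
  by apply: eq_bigr => i _; rewrite linearZ /= rowK row_mxKr !mxE mulr1.
have [j mj] : exists j, 0 < mu 0 j.
  apply: contrapT => nex; move/eqP: mu0; apply; apply/rowP => j; rewrite mxE.
  have mule i : mu 0 i <= 0 by rewrite leNgt; apply/negP => mi; apply: nex; exists i.
  apply/eqP; rewrite -oppr_eq0; apply/eqP.
  apply: (@psumr_eq0P R 'I_n.+1 predT (fun i => - mu 0 i)) => //.
    by move=> i _; rewrite oppr_ge0.
  by rewrite sumrN mu1 oppr0.
(* The least ratio is the largest multiple of [mu] that can be subtracted while all weights stay
   nonnegative; the weight at [i0] then becomes 0. *)
case: (@arg_minP _ _ _ j (fun i => 0 < mu 0 i) (fun i => l i / mu 0 i) mj).
move=> i0 mi0 mini.
set t := l i0 / mu 0 i0.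
have t0 : 0 <= t by rewrite divr_ge0 // ltW.
pose l' i := l i - t * mu 0 i.
have l'0 : l' i0 = 0 by rewrite /l' /t divfK ?subrr // gt_eqF.
exists (fun i => l' (lift i0 i)), (fun i => c (lift i0 i)); split => //.
- move=> i; rewrite /l'; set k := lift i0 i; rewrite subr_ge0.
  have [mk|mk] := ltP 0 (mu 0 k); last first.
    by apply: le_trans (l0 k); rewrite mulr_ge0_le0.
  by rewrite -ler_pdivlMr //; exact: mini.
- have : \sum_i l' i = 1 by rewrite sumrB -mulr_sumr mu1 mulr0 subr0.
  by rewrite (bigD1_ord i0) //= l'0 add0r.
- transitivity (\sum_i l' i *: c i).
    under [RHS]eq_bigr => i _ do rewrite scalerBl -scalerA.
    by rewrite sumrB -scaler_sumr muc scaler0 subr0.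
  by rewrite (bigD1_ord i0) //= l'0 scale0r add0r.
Qed.

(** Reduction shortens a long combination and padding with a zero weight lengthens a short one, so
    [hull A m.+1] is the whole convex hull. *)
Lemma caratheodory A n p : hull A n p -> hull A m.+1 p.
Proof.
have pad k q : hull A k.+1 q -> hull A k.+2 q.
  move=> hq; case: (hq) => l [c [_ _ Ac _]].
  have := hull_join (t := 0) hq (Ac ord0).
  by rewrite scale0r add0r subr0 scale1r lexx ler01; apply.
elim: n p => [p [l [c [_ + _ _]]]|n IHn p hp].
  by rewrite big_ord0 => /esym/eqP; rewrite oner_eq0.
have [mn|nm] := ltnP m n; first by apply/IHn/hull_reduce.
rewrite -(subnKC nm); elim: (m - n)%N => [|k IHk]; first by rewrite addn0.
by rewrite addnS; exact: pad.
Qed.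

Lemma row_coord_continuous (T : topologicalType) n (i : 'I_n) :
  continuous (fun v : 'rV[T]_n => v ord0 i).
Proof.
move=> v s /= vs; exists (fun a j => if (a, j) == (ord0, i) then s else setT).
  move=> a j; case: eqP => [[-> ->]|_] //; exact: filterT.
by move=> w /(_ ord0 i); rewrite eqxx.
Qed.

Lemma continuous_sum (T : topologicalType) (V : normedModType R) n
    (f : 'I_n -> T -> V) :
  (forall i, continuous (f i)) -> continuous (fun x => \sum_i f i x).
Proof.
by move=> cf x; apply: cvg_big => [|i _]; [exact: add_continuous|exact: cf].
Qed.

Lemma closed_superlevel (T : topologicalType) (f : T -> R) a :
  continuous f -> closed [set x | a <= f x].
Proof.
move=> /continuous_closedP cf.
by rewrite (_ : [set x | _] = f @^-1` [set y | a <= y]) //; apply: cf; exact: closed_ge.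
Qed.

Lemma closed_sublevel (T : topologicalType) (f : T -> R) a :
  continuous f -> closed [set x | f x <= a].
Proof.
move=> /continuous_closedP cf.
by rewrite (_ : [set x | _] = f @^-1` [set y | y <= a]) //; apply: cf; exact: closed_le.
Qed.

Lemma compact_hull A n : compact A -> compact (hull A n).
Proof.
move=> cA.
pose S := [set l : 'rV[R]_n | forall i, l ord0 i \in `[0, 1]] `&`
  [set l : 'rV[R]_n | \sum_i l ord0 i = 1].
pose V := [set v : 'rV['rV[R]_m]_n | forall i, A (v ord0 i)].
have cS : compact S.
  apply: compact_closedI.
    apply: (@rV_compact _ _ (fun=> `[(0 : R), 1]%classic)) => _.
    exact: segment_compact.
  have /continuous_closedP : continuous (fun l : 'rV[R]_n => \sum_i l ord0 i).
    by apply: continuous_sum => i; exact: row_coord_continuous.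
  by move=> /(_ [set 1]); apply; exact: closed_eq.
have cV : compact V by exact: (@rV_compact _ _ (fun=> A)).
pose f (lv : 'rV[R]_n * 'rV['rV[R]_m]_n) := \sum_i lv.1 ord0 i *: lv.2 ord0 i.
have cf : continuous f.
  apply: continuous_sum => i x.
  apply: cvgZ.
    apply: (@continuous_comp _ _ _ fst (fun l : 'rV[R]_n => l ord0 i)).
      exact: cvg_fst.
    exact: row_coord_continuous.
  apply: (@continuous_comp _ _ _ snd (fun l : 'rV['rV[R]_m]_n => l ord0 i)).
    exact: cvg_snd.
  exact: row_coord_continuous.
rewrite (_ : hull A n = f @` (S `*` V)).
  apply: continuous_compact; last exact: compact_setX.
  exact: continuous_subspaceT.
apply/seteqP; split => [p [l [c [l0 l1 Ac ->]]]|p].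
  exists (\row_i l i, \row_i c i); last first.
    by rewrite /f /=; apply: eq_bigr => i _; rewrite !mxE.
  split => /=; last by move=> i; rewrite mxE.
  split => /= [i|]; last by rewrite -l1; apply: eq_bigr => i _; rewrite mxE.
  rewrite mxE in_itv /= l0 /= -l1 (bigD1 i) //= lerDl sumr_ge0 //.
move=> [[l v] [[/= l01 l1] Av] <-]; exists (l ord0), (v ord0); split => //.
by move=> i; have := l01 i; rewrite in_itv /= => /andP[].
Qed.

Definition dotr p q : R := \sum_j p ord0 j * q ord0 j.

Lemma dotrDr p q1 q2 : dotr p (q1 + q2) = dotr p q1 + dotr p q2.
Proof. by rewrite -big_split; apply: eq_bigr => j _; rewrite mxE mulrDr. Qed.

Lemma dotrZr p t q : dotr p (t *: q) = t * dotr p q.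
Proof. by rewrite mulr_sumr; apply: eq_bigr => j _; rewrite mxE mulrCA. Qed.

Lemma dotrC p q : dotr p q = dotr q p.
Proof. by apply: eq_bigr => j _; rewrite mulrC. Qed.

Lemma dotr_sqrD p q t :
  dotr (p + t *: q) (p + t *: q) =
  dotr p p + 2 * t * dotr p q + t ^+ 2 * dotr q q.
Proof.
rewrite dotrDr dotrZr ![dotr (p + _) _]dotrC !dotrDr !dotrZr [dotr q p]dotrC.
by ring.
Qed.

Lemma dotr_ge0 p : 0 <= dotr p p.
Proof. by apply: sumr_ge0 => j _; rewrite -expr2 sqr_ge0. Qed.

Lemma dotr_eq0 p : dotr p p <= 0 -> p = 0.
Proof.
move=> pp; have {}pp : dotr p p = 0 by apply/le_anti; rewrite pp dotr_ge0.
apply/rowP => j; rewrite mxE; apply/eqP; rewrite -sqrf_eq0 expr2; apply/eqP.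
apply: (psumr_eq0P _ pp) => // i _; by rewrite -expr2 sqr_ge0.
Qed.

Lemma nonneg_slope (a b : R) :
  (forall t, 0 <= t <= 1 -> 0 <= t * a + t ^+ 2 * b) -> 0 <= a.
Proof.
move=> H; rewrite leNgt; apply/negP => a0.
(* Exceeds both - a and |b|, so that t = - a / s lies in [0, 1] and t |b| < - a: the linear term
   outweighs the quadratic one. *)
pose s := `|b| - a + 1.
have s0 : 0 < s by rewrite /s; have := normr_ge0 b; lra.
have tI : 0 <= - a / s <= 1.
  apply/andP; split; first by rewrite divr_ge0 // ltW // oppr_gt0.
  by rewrite ler_pdivrMr // mul1r /s; have := normr_ge0 b; lra.
have := H _ tI; set t := - a / s => Ht.
have t0 : 0 < t by rewrite divr_gt0 ?oppr_gt0.
have : 0 <= a + t * b.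
  by move: Ht; rewrite expr2 -mulrA -mulrDr pmulr_rge0.
rewrite leNgt => /negP; apply.
have tb : t * b <= t * `|b| by rewrite ler_pM2l // ler_norm.
apply: le_lt_trans (lerD (lexx a) tb) _.
have ts : t * s = - a by rewrite /t divfK // gt_eqF.
have : t * `|b| < t * s by rewrite ltr_pM2l // /s; lra.
lra.
Qed.

(* The nearest point q to p in the hull satisfies <p - q, c - q> <= 0 on A;
   testing the hypothesis with v = p - q then forces p = q. *)
Lemma hull_separation A p : compact A ->
  (forall v, exists2 c, A c & dotr v p <= dotr v c) -> hull A m.+1 p.
Proof.
move=> cA sep.
have [c0 Ac0 _] := sep 0.
have h0 : hull A m.+1 !=set0.
  exists c0; apply: (caratheodory (n := 1)); exists (fun=> 1), (fun=> c0).
  by split; rewrite ?big_ord1 ?scale1r.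
pose F q := dotr (p - q) (p - q).
have cF : continuous F.
  apply: (@continuous_sum _ R _
    (fun j q => (p - q) ord0 j * (p - q) ord0 j)) => j q.
  have cj : {for q, continuous (fun q' : 'rV[R]_m => (p - q') ord0 j)}.
    rewrite (_ : (fun _ => _) = (fun q' : 'rV[R]_m => p ord0 j - q' ord0 j)).
      exact: (cvgB (cvg_cst (p ord0 j)) (@row_coord_continuous R m j q)).
    by apply/funext => q'; rewrite !mxE.
  exact: (cvgM cj cj).
have [q hq minq] := compact_EVT_min h0 (compact_hull (n := m.+1) cA)
  (continuous_subspaceT cF).
move: hq; rewrite inE => hq.
pose v := p - q.
have vc c : A c -> dotr v (c - q) <= 0.
  move=> Ac; rewrite -oppr_ge0.
  suff: 0 <= - dotr v (c - q) *+ 2 by rewrite pmulrn_lge0.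
  apply: (nonneg_slope (b := dotr (c - q) (c - q))) => t tI.
  have := minq (t *: c + (1 - t) *: q).
  (* A point of the segment from [q] to [c] may use [m.+2] points; Caratheodory brings it back to
     the hull over which [q] is nearest. *)
  rewrite inE => /(_ (caratheodory (hull_join hq Ac tI))).
  rewrite -subr_ge0 /F.
  have -> : p - (t *: c + (1 - t) *: q) = v + (- t) *: (c - q).
    by apply/rowP => j; rewrite !mxE; ring.
  by rewrite dotr_sqrD -/v; congr (0 <= _); ring.
have [c Ac] := sep v.
have e1 : dotr v p = dotr v v + dotr v q by rewrite -dotrDr subrK.
have e2 : dotr v c = dotr v (c - q) + dotr v q by rewrite -dotrDr subrK.
rewrite e1 e2 lerD2r => vv.
have /subr0_eq -> // : v = 0 by apply: dotr_eq0; exact: le_trans vv (vc _ Ac).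
Qed.

End ConvexHull.

(** * Finite-dimensional spaces over a real form *)

Lemma rV_norm_le (R : realType) n (a : 'rV[R]_n) M :
  0 <= M -> (forall j, `|a ord0 j| <= M) -> `|a| <= M.
Proof.
move=> M0 aM; rewrite [`|a|]mx_normrE; apply/bigmax_leP; split => // -[i j] _ /=.
by rewrite ord1.
Qed.

Lemma le_rV_norm (R : realType) n (a : 'rV[R]_n) j : `|a ord0 j| <= `|a|.
Proof. by rewrite [leRHS]mx_normrE; apply/bigmax_geP; right; exists (ord0, j). Qed.

Lemma rV_closed_ball_compact (R : realType) n (M : R) :
  compact [set a : 'rV[R]_n | `|a| <= M].
Proof.
apply: bounded_closed_compact.
  exists M; split; first exact: num_real.
  by move=> y My a /= aM; exact: le_trans aM (ltW My).
by apply: closed_sublevel; exact: norm_continuous.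
Qed.

(** A spanning family of least size is free, and freeness forces the coefficients, chosen separately
    for each vector, to depend linearly on it. *)
Lemma findim_coord (K : numFieldType) (V : lmodType K) : findim V ->
  exists n (e : 'I_n -> V) (k : 'I_n -> V -> K),
    (forall i a x y, k i (a *: x + y) = a * k i x + k i y) /\
    (forall x, x = \sum_i k i x *: e i).
Proof.
pose P n := exists e : 'I_n -> V,
  forall v, exists c : 'I_n -> K, v = \sum_(i < n) c i *: e i.
move=> [n0 Pn0]; have exP : exists n, `[< P n >] by exists n0; apply/asboolP.
case: (ex_minnP exP) => n /asboolP[e espan] nmin.
have free (c : 'I_n -> K) : \sum_i c i *: e i = 0 -> forall j, c j = 0.
  case: n e espan nmin c => [|n] e espan nmin c c0 j; first by case: j.
  apply/eqP; apply/negP => /negP cj0.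
  suff /nmin : `[< P n >] by rewrite ltnn.
  apply/asboolP; exists (fun i => e (lift j i)) => v.
  have [d vd] := espan v.
  exists (fun i => d (lift j i) - d j / c j * c (lift j i)).
  transitivity (\sum_i (d i - d j / c j * c i) *: e i).
    under [RHS]eq_bigr => i _ do rewrite scalerBl -scalerA.
    by rewrite sumrB -scaler_sumr c0 scaler0 subr0.
  by rewrite (bigD1_ord j) //= divfK // subrr scale0r add0r.
have [k kE] := choice espan.
exists n, e, (fun i x => k x i); split => // i a x y.
apply/eqP; rewrite -subr_eq0; apply/eqP; move: i.
apply: (free (fun i => k (a *: x + y) i - (a * k x i + k y i))).
under eq_bigr => i _ do rewrite scalerBl scalerDl -scalerA.
by rewrite sumrB big_split /= -scaler_sumr -!kE subrr.
Qed.

Section LinearMaps.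
Context {K : pzRingType} {V W : lmodType K} {f : V -> W} (lf : linear f).

Lemma linear_at0 : f 0 = 0.
Proof. by have := lf (-1) 0 0; rewrite scaleN1r oppr0 addr0 scaleN1r addNr. Qed.

Lemma linear_scale c x : f (c *: x) = c *: f x.
Proof. by rewrite -[c *: x]addr0 lf linear_at0 addr0. Qed.

Lemma linear_sumZ n (c : 'I_n -> K) (v : 'I_n -> V) :
  f (\sum_i c i *: v i) = \sum_i c i *: f (v i).
Proof.
have fD x y : f (x + y) = f x + f y by rewrite -[x]scale1r lf !scale1r.
rewrite (big_morph f fD linear_at0).
by apply: eq_bigr => i _; rewrite linear_scale.
Qed.

End LinearMaps.

(* [K] is a scalar field whose elements are [inj (re z) + inj (im z) * w]:
   either [K = R] with [w = 0], or [K = R[i]] with [w = 'i]. *)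
Record real_form (R : realType) (K : numFieldType) (inj : {rmorphism R -> K})
    (re im : K -> R) (w : K) : Prop := RealForm {
  rf_le : forall a b, (inj a <= inj b) = (a <= b);
  rf_ge0 : forall z, 0 <= z -> inj (re z) = z;
  rf_reD : forall y z, re (y + z) = re y + re z;
  rf_reZ : forall a z, re (inj a * z) = a * re z;
  rf_re_norm : forall z, `|re z| <= re `|z|;
  rf_im_norm : forall z, `|im z| <= re `|z|;
  rf_dec : forall z, z = inj (re z) + inj (im z) * w;
  rf_dual : forall h : K -> R, (forall y z, h (y + z) = h y + h z) ->
    (forall a z, h (inj a * z) = a * h z) -> exists u, forall z, h z = re (u * z) }.

Section RealForm.
Context {R : realType} {K : numFieldType} {inj : {rmorphism R -> K}}.
Context {re im : K -> R} {w : K} (rf : real_form inj re im w).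

Lemma re_inj a : re (inj a) = a.
Proof.
rewrite -[inj a]mulr1 (rf_reZ rf).
have /fmorph_inj -> : inj (re 1) = inj 1 by rewrite (rf_ge0 rf) // rmorph1.
by rewrite mulr1.
Qed.

Lemma re0 : re 0 = 0.
Proof. by rewrite -(rmorph0 inj) re_inj. Qed.

Lemma re_sum I (r : seq I) (F : I -> K) :
  re (\sum_(i <- r) F i) = \sum_(i <- r) re (F i).
Proof. by elim/big_ind2: _ => [|x1 x2 y1 y2 <- <-|//]; [exact: re0|exact: (rf_reD rf)]. Qed.

(** The choice [y = z^-1] would give real part 1. Identities in [K] thus reduce to real parts tested
    on all multiples. *)
Lemma re_separates z : (forall y, re (y * z) = 0) -> z = 0.
Proof.
move=> z0; apply/eqP; apply/negP => /negP nz.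
have := z0 z^-1; rewrite mulVf // -(rmorph1 inj) re_inj => /eqP.
by rewrite oner_eq0.
Qed.

(** Norms take values in [K], whose order is only partial over the complex numbers; suprema and
    compactness arguments need this real copy. *)
Definition rnorm (V : normedZmodType K) (x : V) : R := re `|x|.

Section Norm.
Context {V : normedModType K}.
Implicit Types x y : V.

Lemma inj_rnorm (W : normedZmodType K) (x : W) : inj (rnorm x) = `|x|.
Proof. by rewrite (rf_ge0 rf). Qed.

Lemma rnorm_eq (W : normedZmodType K) (x : W) a : `|x| = inj a <-> rnorm x = a.
Proof. by rewrite -inj_rnorm; split => [/fmorph_inj|->]. Qed.

Lemma rnorm_ge0 (W : normedZmodType K) (x : W) : 0 <= rnorm x.
Proof. by rewrite -(rf_le rf) inj_rnorm rmorph0. Qed.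

Lemma rnormD x y : rnorm (x + y) <= rnorm x + rnorm y.
Proof. by rewrite -(rf_le rf) rmorphD !inj_rnorm ler_normD. Qed.

Lemma rnormZ u x : rnorm (u *: x) = rnorm u * rnorm x.
Proof. by rewrite /rnorm normrZ -{1}[`|u|]inj_rnorm (rf_reZ rf). Qed.

Lemma rnorm_inj a : rnorm (inj a) = `|a|.
Proof.
have pos b : 0 <= b -> rnorm (inj b) = b.
  move=> b0; rewrite /rnorm ger0_norm ?re_inj //.
  by rewrite -(rmorph0 inj) (rf_le rf).
have [a0|/ltW a0] := leP 0 a; first by rewrite pos // ger0_norm.
rewrite -[a]opprK rmorphN /rnorm normrN [RHS]normrN [RHS]ger0_norm ?oppr_ge0 //.
by rewrite -/(rnorm _) pos // oppr_ge0.
Qed.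

Lemma rnorm_eq0 x : rnorm x = 0 -> x = 0.
Proof. by move=> x0; apply/eqP; rewrite -normr_eq0 -inj_rnorm x0 rmorph0. Qed.

Lemma rnorm0 : rnorm (0 : V) = 0.
Proof. by rewrite /rnorm normr0 re0. Qed.

Lemma rnorm_sum I (r : seq I) (F : I -> V) :
  rnorm (\sum_(i <- r) F i) <= \sum_(i <- r) rnorm (F i).
Proof.
elim/big_ind2: _ => [|x1 x2 y1 y2 h1 h2|//]; first by rewrite rnorm0.
exact: le_trans (rnormD _ _) (lerD h1 h2).
Qed.

Lemma normalize x : x != 0 -> rnorm (inj (rnorm x)^-1 *: x) = 1.
Proof.
move=> x0; rewrite rnormZ rnorm_inj ger0_norm ?invr_ge0 ?rnorm_ge0 // mulVf //.
by apply: contra x0 => /eqP/rnorm_eq0 ->.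
Qed.

Definition rcomb N (u : 'I_N -> V) (a : 'rV[R]_N) : V :=
  \sum_j inj (a ord0 j) *: u j.

Lemma rcomb_rnorm_continuous N (u : 'I_N -> V) :
  continuous (fun a => rnorm (rcomb u a)).
Proof.
pose L := \sum_j rnorm (u j).
have L0 : 0 <= L by apply: sumr_ge0 => j _; exact: rnorm_ge0.
have lip a b : rnorm (rcomb u a) - rnorm (rcomb u b) <= L * `|a - b|.
  rewrite lerBlDr.
  have -> : rcomb u a = rcomb u (a - b) + rcomb u b.
    rewrite -big_split; apply: eq_bigr => j _ /=.
    by rewrite -scalerDl -rmorphD !mxE subrK.
  apply: le_trans (rnormD _ _) _; rewrite lerD2r.
  apply: le_trans (rnorm_sum _ _) _; rewrite mulr_suml; apply: ler_sum => j _.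
  by rewrite rnormZ rnorm_inj mulrC ler_wpM2l ?rnorm_ge0 // le_rV_norm.
move=> a; have FF : Filter (nbhs a) by exact: nbhs_filter.
apply/(cvgrPdist_lt (FF := FF)) => e e0; apply/nbhs_ballP.
exists (e / (L + 1)); first by rewrite /= divr_gt0 // ltr_wpDl.
move=> b; rewrite mx_norm_ball /= => ab.
apply: (@le_lt_trans _ _ (L * `|a - b|)).
  by rewrite ler_norml lip andbT lerNl opprB distrC lip.
apply: (@le_lt_trans _ _ ((L + 1) * `|a - b|)).
  by rewrite ler_wpM2r // lerDl.
by rewrite mulrC -ltr_pdivlMr // ltr_wpDl.
Qed.

End Norm.

Lemma linear_rcomb (V W : normedModType K) (f : V -> W) N (u : 'I_N -> V) a :
  linear f -> f (rcomb u a) = rcomb (fun j => f (u j)) a.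
Proof. by move=> lf; rewrite /rcomb (linear_sumZ lf). Qed.

(** Turns a spanning family over [K] into one over the reals. In the real case [w] is 0 and the
    second half vanishes, so the family spans without having to be free. *)
Definition frame n (V : lmodType K) (e : 'I_n -> V) (j : 'I_(n + n)) : V :=
  match fintype.split j with inl i => e i | inr i => w *: e i end.

Definition frame_coord n (k : 'I_n -> K) : 'rV[R]_(n + n) :=
  row_mx (\row_i re (k i)) (\row_i im (k i)).

Lemma frame_coordE n (V : normedModType K) (e : 'I_n -> V) k :
  rcomb (frame e) (frame_coord k) = \sum_i k i *: e i.
Proof.
rewrite /rcomb big_split_ord /= -big_split; apply: eq_bigr => i _ /=.
rewrite /frame (unsplitK (inl i)) (unsplitK (inr i)) row_mxEl row_mxEr !mxE.
by rewrite scalerA -scalerDl -(rf_dec rf).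
Qed.

Lemma frame_coord_le n (k : 'I_n -> K) M :
  0 <= M -> (forall i, rnorm (k i) <= M) -> `|frame_coord k| <= M.
Proof.
move=> M0 kM; apply: rV_norm_le => // j; rewrite /frame_coord mxE.
by case: fintype.splitP => i _; rewrite mxE; apply: le_trans (kM i);
  [exact: (rf_re_norm rf)|exact: (rf_im_norm rf)].
Qed.

(* The norm is bounded below on the compact set of bounded parameters whose
   coordinates have sum of norms at least 1. *)
Lemma coord_bounded (V : normedModType K) n (e : 'I_n -> V)
    (k : 'I_n -> V -> K) :
  (forall i a x y, k i (a *: x + y) = a * k i x + k i y) ->
  (forall x, x = \sum_i k i x *: e i) ->
  exists2 M, 0 <= M & forall i x, rnorm (k i x) <= M * rnorm x.
Proof.
move=> klin kE.
have kl i : linear (k i : V -> K^o) by move=> a x y; exact: klin.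
pose s x := \sum_i rnorm (k i x).
have s_ge i x : rnorm (k i x) <= s x.
  rewrite /s (bigD1 i) //= lerDl sumr_ge0 // => j _; exact: rnorm_ge0.
have s0 x : 0 <= s x by apply: sumr_ge0 => i _; exact: rnorm_ge0.
pose S := [set a : 'rV[R]_(n + n) | `|a| <= 1] `&`
  [set a | 1 <= s (rcomb (frame e) a)].
have cS : compact S.
  apply: compact_closedI; first exact: rV_closed_ball_compact.
  apply: closed_superlevel; apply: (@continuous_sum _ _ R) => i.
  rewrite (_ : (fun _ => _) =
    (fun a => rnorm (rcomb (fun j => k i (frame e j) : K^o) a))).
    exact: rcomb_rnorm_continuous.
  by apply/funext => a; rewrite -(linear_rcomb _ _ (kl i)).
(* Division by [s x] makes the norms of the coordinates sum to 1, hence each of them is at most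
   1. *)
have scaled x : 0 < s x -> S (frame_coord (fun i => k i (inj (s x)^-1 *: x))).
  move=> sx.
  have kZ i : rnorm (k i (inj (s x)^-1 *: x)) = (s x)^-1 * rnorm (k i x).
    have k0 : k i 0 = 0.
      by have := klin i (-1) 0 0; rewrite scaleN1r oppr0 addr0 mulN1r addNr.
    rewrite -[inj _ *: x]addr0 klin k0 addr0 (@rnormZ K^o) rnorm_inj.
    by rewrite ger0_norm // invr_ge0 ltW.
  split => /=.
    apply: frame_coord_le => // i; rewrite kZ.
    by rewrite mulrC ler_pdivrMr // mul1r.
  rewrite frame_coordE -kE /s.
  under eq_bigr => i _ do rewrite kZ.
  by rewrite -mulr_sumr mulVf // gt_eqF.
(* By [scaled], an empty [S] means that all coordinates vanish, and then [M = 0] serves. *)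
have [[a0 Sa0]|S0] := pselect (S !=set0); last first.
  exists 0 => // i x; rewrite mul0r leNgt; apply/negP => kx; apply: S0.
  by eexists; apply: (scaled x); exact: lt_le_trans kx (s_ge i x).
have cont : continuous (fun a => rnorm (rcomb (frame e) a)).
  exact: rcomb_rnorm_continuous.
have [a1] := compact_EVT_min (ex_intro _ _ Sa0) cS (continuous_subspaceT cont).
rewrite inE => -[_ /= Sa1] mina1.
set mu := rnorm (rcomb (frame e) a1) in mina1.
have mu0 : 0 < mu.
  rewrite lt_neqAle rnorm_ge0 andbT; apply/negP => /eqP/esym mu0.
  move: Sa1; rewrite (rnorm_eq0 mu0) /s big1 ?ler10 // => i _.
  have := klin i (-1) 0 0; rewrite scaleN1r oppr0 addr0 mulN1r addNr => ->.
  exact: (@rnorm0 K^o).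
exists mu^-1; first by rewrite invr_ge0 ltW.
move=> i x; have [sx|sx] := ltP 0 (s x); last first.
  apply: le_trans (s_ge i x) _; apply: le_trans sx _.
  by rewrite mulr_ge0 ?rnorm_ge0 // invr_ge0 ltW.
apply: le_trans (s_ge i x) _.
have := mina1 _ (mem_set (scaled x sx)); rewrite frame_coordE -kE rnormZ rnorm_inj.
rewrite ger0_norm ?invr_ge0 // ler_pdivlMl // => h.
by rewrite ler_pdivlMl // mulrC.
Qed.

End RealForm.

Arguments rnorm {R K} re {V} x.
Arguments rcomb {R K} inj {V N} u a.
Arguments frame {K} w {n V} e j.
Arguments frame_coord {R K} re im {n} k.

(** * Hahn-Banach in finite dimension *)

Section HahnBanach.
Context {R : realType} {K : numFieldType} {inj : {rmorphism R -> K}}.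
Context {re im : K -> R} {w : K} (rf : real_form inj re im w).
Context {Y : normedModType K}.
Implicit Types (p g : Y -> R) (x y e : Y).

Definition sublinear p : Prop :=
  (forall x y, p (x + y) <= p x + p y) /\
  (forall t x, 0 <= t -> p (inj t *: x) = t * p x).

Lemma sublinear0 p : sublinear p -> p 0 = 0.
Proof. by move=> [_ pZ]; rewrite -(scale0r 0) -(rmorph0 inj) pZ // mul0r. Qed.

(* [p' x = inf_(t >= 0) (p (x + t e) - t p e)] is linear along [e]. *)
Lemma sublinear_step p e : sublinear p ->
  exists p', [/\ sublinear p', forall x, p' x <= p x & p' (- e) <= - p e].
Proof.
move=> sp; have [pD pZ] := sp.
pose V x t := p (x + inj t *: e) - t * p e.
pose p' x := inf [set V x t | t in [set t | 0 <= t]].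
have ne x : [set V x t | t in [set t | 0 <= t]] !=set0.
  by exists (V x 0), 0 => /=.
(* From t p(e) <= p(x + t e) + p(- x); without a lower bound [inf] would not be a genuine
   infimum. *)
have Vlb x t : 0 <= t -> - p (- x) <= V x t.
  move=> t0; rewrite /V lerBrDr -pZ // addrC lerBlDr.
  by apply: le_trans (pD _ _); rewrite addrAC subrr add0r.
have p'le x t : 0 <= t -> p' x <= V x t.
  move=> t0; apply: ge_inf; last by exists t.
  by exists (- p (- x)) => _ [s s0 <-]; exact: Vlb.
have p'ge x a : (forall t, 0 <= t -> a <= V x t) -> a <= p' x.
  by move=> H; apply: lb_le_inf => // _ [t t0 <-]; exact: H.
have p'Z1 c x : 0 < c -> p' (inj c *: x) <= c * p' x.
  move=> c0; rewrite -ler_pdivrMl //; apply: (p'ge _ _) => t t0.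
  rewrite ler_pdivrMl //.
  apply: le_trans (p'le (inj c *: x) (c * t) _) _; first by rewrite mulr_ge0 // ltW.
  rewrite /V rmorphM -scalerA -scalerDr pZ; last exact: ltW.
  by rewrite mulrBr mulrA.
exists p'; split; first split.
- move=> x y; rewrite -lerBlDr; apply: (p'ge _ _) => s s0.
  rewrite lerBlDr -lerBlDl; apply: (p'ge _ _) => t t0; rewrite lerBlDl.
  apply: le_trans (p'le _ (s + t) _) _; first exact: addr_ge0.
  rewrite /V rmorphD scalerDl addrACA.
  have := pD (x + inj s *: e) (y + inj t *: e); lra.
- move=> t x; rewrite le_eqVlt => /orP[/eqP<-|t0].
    rewrite rmorph0 scale0r mul0r; apply/le_anti/andP; split.
      apply: le_trans (p'le 0 0 _) _ => //.
      by rewrite /V rmorph0 scale0r addr0 mul0r subr0 sublinear0.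
    by apply: (p'ge _ _) => s s0; rewrite /V add0r pZ // subrr.
  apply/le_anti; rewrite p'Z1 //=.
  have := p'Z1 t^-1 (inj t *: x); rewrite invr_gt0 => /(_ t0).
  rewrite scalerA -rmorphM mulVf ?gt_eqF // rmorph1 scale1r.
  by rewrite ler_pdivlMl.
- move=> x; apply: le_trans (p'le x 0 _) _ => //.
  by rewrite /V rmorph0 scale0r addr0 mul0r subr0.
- apply: le_trans (p'le (- e) 1 _) _ => //.
  by rewrite /V rmorph1 scale1r addNr sublinear0 // mul1r sub0r.
Qed.

(** Linearity along [e] is recorded as an inequality that survives every later decrease of the
    function, so finitely many steps settle a whole spanning family. *)
Lemma sublinear_iter (s : seq Y) p : sublinear p ->
  exists p', [/\ sublinear p', forall x, p' x <= p x &
    forall e, e \in s -> p' e + p' (- e) <= 0].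
Proof.
elim: s p => [|e s IHs] p sp; first by exists p; split.
have [p1 [sp1 p1p p1e]] := sublinear_step e sp.
have [p2 [sp2 p2p1 p2s]] := IHs _ sp1.
exists p2; split => // [x|e']; first exact: le_trans (p2p1 x) (p1p x).
rewrite inE => /orP[/eqP ->|]; last exact: p2s.
have := p2p1 e; have := p2p1 (- e); have := p1p e; lra.
Qed.

(** The first step, along [y0], gives p(- y0) <= - |y0|; later decreases preserve this, and it
    yields g(y0) = |y0| once the function is odd. Oddness spreads from the frame by subadditivity,
    and an odd sublinear function is real linear. *)
Lemma hahn_banach_real y0 : findim Y -> exists g : Y -> R,
  [/\ forall x y, g (x + y) = g x + g y, forall a x, g (inj a *: x) = a * g x,
      forall x, g x <= rnorm re x & g y0 = rnorm re y0].
Proof.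
move=> /findim_coord[n [e [k [_ kE]]]].
have snorm : sublinear (rnorm re (V := Y)).
  split=> [x y|t x t0]; first exact: (rnormD rf).
  by rewrite (rnormZ rf) (rnorm_inj rf) ger0_norm.
have [p0 [sp0 p0n p0y]] := sublinear_step y0 snorm.
have [p [sp pp0 ps]] := sublinear_iter [seq frame w e j | j : 'I_(n + n)] sp0.
have [pD pZ] := sp.
have p_ge x : 0 <= p x + p (- x) by rewrite -(sublinear0 sp) -(subrr x).
have pN x : p (- x) = - p x.
  apply/eqP; rewrite -addr_eq0 addrC; apply/eqP/le_anti.
  rewrite p_ge andbT [x]kE -(frame_coordE rf) /rcomb.
  elim/big_ind: _ => [|a b a0 b0|j _].
  - by rewrite oppr0 sublinear0 // addr0.
  - by rewrite opprD; have := pD a b; have := pD (- a) (- b); lra.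
  - have /ps pj : frame w e j \in [seq frame w e j | j : 'I_(n + n)].
      by apply/fintype.imageP; exists j.
    set a := frame_coord _ _ _ _ _; set v := frame w e j in pj *.
    have [a0|/ltW a0] := leP 0 a.
      by rewrite -scalerN !pZ // -mulrDr mulr_ge0_le0.
    rewrite -[a]opprK rmorphN scaleNr opprK -scalerN !pZ ?oppr_ge0 //.
    by rewrite -mulrDr [p (- v) + _]addrC mulr_ge0_le0 // oppr_ge0.
have pDE x y : p (x + y) = p x + p y.
  apply/le_anti; rewrite pD /=.
  by have := pD (x + y) (- y); rewrite addrK pN; lra.
exists p; split => //.
- move=> a x; have [a0|/ltW a0] := leP 0 a; first exact: pZ.
  by rewrite -[a]opprK rmorphN scaleNr pN pZ ?oppr_ge0 // [RHS]mulNr.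
- by move=> x; exact: le_trans (pp0 x) (p0n x).
- apply/le_anti; rewrite (le_trans (pp0 _) (p0n _)) /=.
  by have := pp0 (- y0); rewrite pN; have := p0y; lra.
Qed.

(* [ys y] is the scalar representing the real functional [z |-> g (z *: y)]. *)
Lemma hahn_banach y0 : findim Y -> exists ys : Y -> K,
  [/\ linear (ys : Y -> K^o), forall y, rnorm re (ys y) <= rnorm re y &
      re (ys y0) = rnorm re y0].
Proof.
move=> fY; have [g [gD gZ gn gy0]] := hahn_banach_real y0 fY.
have /choice[ys ysE] : forall y, exists u, forall z, g (z *: y) = re (u * z).
  move=> y; apply: (rf_dual rf (h := fun z => g (z *: y))) => [a b|a z].
    by rewrite scalerDl gD.
  by rewrite -scalerA gZ.
exists ys; split.
- move=> a x y; apply/eqP; rewrite -subr_eq0; apply/eqP.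
  apply: (re_separates rf) => z.
  rewrite mulrBr (rf_reD rf).
  have -> : - (z * (a *: (ys x : K^o) + ys y)) =
      inj (-1) * (z * (a *: (ys x : K^o) + ys y)).
    by rewrite rmorphN1 mulN1r.
  rewrite (rf_reZ rf) mulrDr (rf_reD rf).
  have -> : z * (a *: (ys x : K^o)) = ys x * (z * a).
    by rewrite mulrA mulrC; congr (_ * _).
  by rewrite ![z * _]mulrC -!ysE scalerDr gD scalerA [a * z]mulrC; lra.
- move=> y; have [y0'|yn0] := eqVneq (ys y) 0.
    by rewrite y0' (@rnorm0 _ _ _ _ _ _ rf K^o) (rnorm_ge0 rf).
  (* This phase turns [ys y] into its modulus, so the bound on [g] at [c *: y] bounds that
     modulus. *)
  pose c := `|ys y| / ys y.
  have nc : rnorm re c = 1.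
    apply/(rnorm_eq rf); rewrite rmorph1 normrM normfV normr_id mulfV //.
    by rewrite normr_eq0.
  rewrite -[leRHS]mul1r -nc -(rnormZ rf); apply: le_trans (gn _).
  by rewrite ysE /c mulrC divfK.
- by rewrite -gy0 -[y0 in g y0]scale1r ysE mulr1.
Qed.

End HahnBanach.

Lemma supremumE d (T : porderType d) (x0 x : T) (A : set T) :
  A !=set0 -> supremums A x -> supremum x0 A = x.
Proof.
move=> /set0P A0 Ax; rewrite /supremum (negbTE A0).
by case: xgetP => [y -> Ay|/(_ x)//]; exact: is_subset1_supremums Ay Ax.
Qed.

Lemma infimumE d (T : porderType d) (x0 x : T) (A : set T) :
  A !=set0 -> infimums A x -> infimum x0 A = x.
Proof.
move=> /set0P A0 Ax; rewrite /infimum (negbTE A0).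
by case: xgetP => [y -> Ay|/(_ x)//]; exact: is_subset1_infimums Ay Ax.
Qed.

(** * Attainment of the G-norm *)

Section Gnorm.
Context {R : realType} {K : numFieldType} {inj : {rmorphism R -> K}}.
Context {re im : K -> R} {w : K} (rf : real_form inj re im w).

(** The order of [K] may be partial, but an upper bound [y] differs from a member of the set by a
    nonnegative element, hence is itself real; the supremum taken in the reals is therefore least in
    [K] too. *)
Lemma sup_injE (A : set R) : A !=set0 -> has_ubound A ->
  supremum 0 [set inj a | a in A] = inj (sup A).
Proof.
move=> [a0 Aa0] ubA; apply: supremumE; first by exists (inj a0), a0.
split=> [_ [a Aa <-]|y uby]; first by rewrite (rf_le rf); exact: ub_le_sup.
have y0 : 0 <= y - inj a0 by rewrite subr_ge0; apply: uby; exists a0.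
have -> : y = inj (a0 + re (y - inj a0)).
  by rewrite rmorphD (rf_ge0 rf) // addrC subrK.
rewrite (rf_le rf); apply: ge_sup; first by exists a0.
move=> a Aa; rewrite -(rf_le rf) rmorphD (rf_ge0 rf) // addrC subrK.
by apply: uby; exists a.
Qed.

Lemma inf_injE (A : set R) : A !=set0 -> has_lbound A ->
  infimum 0 [set inj a | a in A] = inj (inf A).
Proof.
move=> [a0 Aa0] lbA; apply: infimumE; first by exists (inj a0), a0.
split=> [_ [a Aa <-]|y lby]; first by rewrite (rf_le rf); exact: ge_inf.
have y0 : 0 <= inj a0 - y by rewrite subr_ge0; apply: lby; exists a0.
have yE : y = inj (a0 - re (inj a0 - y)).
  by rewrite rmorphB (rf_ge0 rf) // opprB addrC subrK.
rewrite yE (rf_le rf); apply: lb_le_inf; first by exists a0.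
move=> a Aa; rewrite -(rf_le rf) -yE.
by apply: lby; exists a.
Qed.

(** Bounded coordinates confine suitable parameters of all unit vectors to one ball, and the norm
    condition is closed; extrema over the sphere become extrema over [A]. *)
Lemma sphere_param (X : normedModType K) : findim X ->
  exists N (u : 'I_N -> X) (A : set 'rV[R]_N), compact A /\
    forall x, (exists2 a, A a & x = rcomb inj u a) <-> rnorm re x = 1.
Proof.
move=> /findim_coord[n [e [k [kl kE]]]].
have [M M0 kM] := coord_bounded rf kl kE.
pose A := [set a : 'rV[R]_(n + n) | `|a| <= M] `&`
  ([set a | 1 <= rnorm re (rcomb inj (frame w e) a)] `&`
   [set a | rnorm re (rcomb inj (frame w e) a) <= 1]).
exists (n + n)%N, (frame w e), A; split.
  apply: compact_closedI; first exact: rV_closed_ball_compact.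
  have ct := rcomb_rnorm_continuous rf (u := frame w e).
  by apply: closedI; [exact: closed_superlevel|exact: closed_sublevel].
move=> x; split => [[a [_ [/= a1 a2]] ->]|x1]; first by apply/le_anti/andP; split.
have xE : x = rcomb inj (frame w e) (frame_coord re im (k^~ x)).
  by rewrite (frame_coordE rf) -kE.
exists (frame_coord re im (k^~ x)) => //; split.
  apply: (frame_coord_le rf) => // i.
  by apply: le_trans (kM i x) _; rewrite x1 mulr1.
by split => /=; rewrite -xE x1.
Qed.

Context {X Y : normedModType K}.
Implicit Types (G T : X -> Y).

Lemma opnorm_eq1_le G x : opnorm_eq1 G -> rnorm re x <= 1 ->
  rnorm re (G x) <= 1.
Proof.
move=> [ubG _] x1; rewrite -(rf_le rf) (inj_rnorm rf) rmorph1; apply: ubG.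
by exists x => //=; rewrite -(inj_rnorm rf) -(rmorph1 inj) (rf_le rf).
Qed.

Lemma opnorm_eq1_near G d : linear G -> opnorm_eq1 G -> 0 < d ->
  exists2 x, rnorm re x = 1 & 1 - d < rnorm re (G x).
Proof.
move=> lG oG d0; have [_ lub] := oG.
(* Capping [d] at 1 keeps the lower bound nonnegative, which forces [x] to be nonzero. Normalizing
   [x], of norm at most 1, can only increase |G x|. *)
have [x x1 Gx] : exists2 x, rnorm re x <= 1 & 1 - Num.min d 1 < rnorm re (G x).
  apply: contrapT => H.
  have : 1 <= inj (1 - Num.min d 1).
    apply: lub => _ [x /= x1 <-]; rewrite -(inj_rnorm rf) (rf_le rf) leNgt.
    apply/negP => Gx; apply: H; exists x => //.
    by rewrite -(rf_le rf) (inj_rnorm rf) rmorph1.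
  rewrite -(rmorph1 inj) (rf_le rf) lerBrDl gerDr leNgt => /negP; apply.
  by rewrite lt_min d0 ltr01.
have x0 : x != 0.
  apply/eqP => x0; move: Gx; rewrite x0.
  rewrite (linear_at0 lG) (rnorm0 rf) subr_lt0 ltNge.
  by rewrite ge_min lexx orbT.
have nx0 : 0 < rnorm re x.
  rewrite lt_neqAle (rnorm_ge0 rf) andbT eq_sym.
  by apply: contra x0 => /eqP/(rnorm_eq0 rf) ->.
exists (inj (rnorm re x)^-1 *: x); first exact: (normalize rf).
rewrite linear_scale // (rnormZ rf) (rnorm_inj rf) ger0_norm ?invr_ge0 ?(ltW nx0) //.
apply: (@lt_le_trans _ _ (rnorm re (G x))).
  by apply: le_lt_trans Gx; rewrite lerB // ge_min lexx.
by rewrite ler_pdivlMl // ger_pMl // (le_lt_trans _ Gx) // subr_ge0 ge_min lexx orbT.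
Qed.

Lemma Gnorm_attained G T : findim X -> linear G -> opnorm_eq1 G -> linear T ->
  exists x0, [/\ rnorm re x0 = 1, rnorm re (G x0) = 1,
    Gnorm G T = inj (rnorm re (T x0)) &
    forall x, rnorm re x = 1 -> rnorm re (G x) = 1 ->
      rnorm re (T x) <= rnorm re (T x0)].
Proof.
move=> fX lG oG lT.
have [N [u [A [cA sA]]]] := sphere_param fX.
have [x1 /sA[a1 Aa1 _] _] := opnorm_eq1_near lG oG ltr01.
have A0 : A !=set0 by exists a1.
have cont (f : X -> Y) : linear f -> continuous (fun a => rnorm re (f (rcomb inj u a))).
  move=> lf; rewrite (_ : (fun _ => _) = (fun a => rnorm re (rcomb inj (f \o u) a))).
    exact: (rcomb_rnorm_continuous rf).
  by apply/funext => a; rewrite (linear_rcomb _ _ lf).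
have [B TB] : exists B, forall x, rnorm re x = 1 -> rnorm re (T x) <= B.
  have [b _ bmax] := compact_EVT_max A0 cA (continuous_subspaceT (cont T lT)).
  eexists => x /sA[a Aa ->]; apply: bmax; exact/mem_set.
pose D d := [set rnorm re (T x) | x in
  [set x | rnorm re x = 1 /\ 1 - d < rnorm re (G x)]].
have D0 d : 0 < d -> D d !=set0.
  by move=> /(opnorm_eq1_near lG oG)[x ? ?]; exists (rnorm re (T x)), x.
have Dub d : has_ubound (D d) by exists B => _ [x [x1' _] <-]; exact: TB.
pose E := [set sup (D d) | d in [set d | 0 < d]].
have GE : Gnorm G T = inj (inf E).
  rewrite /Gnorm -inf_injE; last 2 first.
  - by exists (sup (D 1)), 1 => //=.
  - exists 0 => _ [d /= /D0[y Dy] <-]; have [x _ yE] := Dy.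
    by apply: le_trans (ub_le_sup (Dub d) Dy); rewrite -yE (rnorm_ge0 rf).
  have setE d : 0 < d -> supremum 0 (Gnorm_set G T (inj d)) = inj (sup (D d)).
    move=> d0; rewrite -sup_injE //; last exact: D0.
    congr (supremum 0 _); apply/seteqP; split.
      move=> _ [x [x1' Gx] <-]; exists (rnorm re (T x)); last exact: (inj_rnorm rf).
      exists x => //; split; first by apply/(rnorm_eq rf); rewrite rmorph1.
      move: Gx; rewrite -(inj_rnorm rf) -(rmorph1 inj) -rmorphB.
      rewrite !lt_neqAle (rf_le rf) => /andP[+ ->]; rewrite andbT.
      by apply: contra => /eqP ->.
    move=> _ [_ [x [x1' Gx] <-] <-]; rewrite (inj_rnorm rf); exists x => //; split.
      by move/(rnorm_eq rf): x1'; rewrite rmorph1.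
    rewrite -(inj_rnorm rf) -(rmorph1 inj) -rmorphB lt_neqAle (rf_le rf) (ltW Gx) andbT.
    by rewrite (inj_eq (fmorph_inj inj)) lt_eqF.
  congr (infimum 0 _); apply/seteqP; split.
    (* A positive [d] of [K] is real, so only real values of [d] have to be considered. *)
    move=> _ [d /= d0 <-]; have dE := rf_ge0 rf (ltW d0).
    have rd0 : 0 < re d.
      rewrite lt_neqAle; apply/andP; split; last first.
        by rewrite -(rf_le rf) rmorph0 dE ltW.
      by apply/eqP => rd; move: d0; rewrite -dE -rd rmorph0 ltxx.
    by exists (sup (D (re d))); [exists (re d)|rewrite -setE // dE].
  move=> _ [_ [d /= d0 <-] <-]; exists (inj d); last exact: setE.
  rewrite /= lt_neqAle -(rmorph0 inj) (rf_le rf) (ltW d0) andbT.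
  by rewrite (inj_eq (fmorph_inj inj)) lt_eqF.
have infE d : 0 < d -> inf E <= sup (D d).
  move=> d0; apply: ge_inf; last by exists d.
  exists 0 => _ [d' /= /D0[y Dy] <-]; have [x _ yE] := Dy.
  by apply: le_trans (ub_le_sup (Dub d') Dy); rewrite -yE (rnorm_ge0 rf).
have Tinf x : rnorm re x = 1 -> rnorm re (G x) = 1 -> rnorm re (T x) <= inf E.
  move=> x1' Gx; apply: lb_le_inf; first by exists (sup (D 1)), 1 => /=.
  move=> _ [d /= d0 <-]; apply: ub_le_sup => //; exists x => //; split => //.
  by rewrite Gx gtrBl.
(* Maximizing the smaller of the two excesses replaces the extraction of a convergent subsequence.
   For each eps, a near-maximizer of |T x| under |G x| > 1 - eps makes both at least - eps; hence
   the maximum is nonnegative and one point satisfies both constraints. *)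
pose fG a := rnorm re (G (rcomb inj u a)) - 1.
pose fT a := rnorm re (T (rcomb inj u a)) - inf E.
have cf : continuous (fG \min fT).
  move=> a; apply: continuous_min.
    exact: (cvgB (cont G lG a) (cvg_cst (1 : R))).
  exact: (cvgB (cont T lT a) (cvg_cst (inf E))).
have [a0 Aa0 a0max] := compact_EVT_max A0 cA (continuous_subspaceT cf).
move: Aa0; rewrite inE => Aa0.
have : 0 <= (fG \min fT) a0.
  apply/ler_addgt0Pr => eps eps0.
  have [_ [x [x1' Gx] <-] Tx] := sup_adherent eps0 (conj (D0 _ eps0) (Dub eps)).
  have /sA[a Aa xE] := x1'.
  have := a0max a (mem_set Aa); rewrite -lerBlDr sub0r; apply: le_trans.
  rewrite /= le_min /fG /fT -xE; have := infE _ eps0.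
  by move=> h; apply/andP; split; lra.
rewrite /= le_min /fG /fT !subr_ge0; set x0 := rcomb inj u a0 => /andP[G1 T1].
have x01 : rnorm re x0 = 1 by apply/sA; exists a0.
have Gx0 : rnorm re (G x0) = 1.
  by apply/le_anti; rewrite G1 andbT opnorm_eq1_le // x01.
have Tx0 : rnorm re (T x0) = inf E by apply/le_anti; rewrite T1 Tinf.
by exists x0; split => //; rewrite Tx0.
Qed.

End Gnorm.

(** * The dual ball of the G-norm *)

Lemma bilinear_continuous (R : realType) (T : topologicalType) p q
    (m : 'I_p -> 'I_q -> R) (f : T -> 'rV[R]_p) (h : T -> 'rV[R]_q) :
  continuous f -> continuous h ->
  continuous (fun x => \sum_l \sum_j f x ord0 l * h x ord0 j * m l j).
Proof.
move=> cf ch; apply: continuous_sum => l; apply: continuous_sum => j x.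
have c1 : {for x, continuous (fun x => f x ord0 l)}.
  apply: (@continuous_comp _ _ _ f (fun b : 'rV[R]_p => b ord0 l)).
    exact: cf.
  exact: row_coord_continuous.
have c2 : {for x, continuous (fun x => h x ord0 j)}.
  apply: (@continuous_comp _ _ _ h (fun b : 'rV[R]_q => b ord0 j)).
    exact: ch.
  exact: row_coord_continuous.
exact: (cvgM (cvgM c1 c2) (cvg_cst (m l j))).
Qed.

Lemma row_continuous (R : realType) (T : topologicalType) n (f : 'I_n -> T -> R) :
  (forall j, continuous (f j)) -> continuous (fun x => \row_j f j x).
Proof.
move=> cf.
rewrite (_ : (fun _ => _) = (fun x => \sum_j f j x *: delta_mx ord0 j)); last first.
  apply/funext => x; rewrite [LHS]row_sum_delta.
  by apply: eq_bigr => j _; rewrite mxE.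
apply: continuous_sum => j x.
by apply: cvgZr_tmp; exact: cf.
Qed.

Section Main.
Context {R : realType} {K : numFieldType} {inj : {rmorphism R -> K}}.
Context {re im : K -> R} {w : K} (rf : real_form inj re im w).

(** A functional is parametrized by its values at the [e i], which |ys (e i)| <= |e i| keeps
    bounded; the norm bound is an intersection of closed conditions, one for each [y]. *)
Lemma dual_ball_param (Y : normedModType K) : findim Y ->
  exists P (g : 'I_P -> Y -> K^o) (B : set 'rV[R]_P),
    [/\ forall l, linear (g l), compact B,
      forall b, B b -> forall y, rnorm re (rcomb inj (g^~ y) b) <= rnorm re y &
      forall ys : Y -> K, linear (ys : Y -> K^o) ->
        (forall y, rnorm re (ys y) <= rnorm re y) ->
        exists2 b, B b & forall y, ys y = rcomb inj (g^~ y) b].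
Proof.
move=> /findim_coord[n [e [k [kl kE]]]].
pose g (l : 'I_(n + n)) (y : Y) : K^o := frame w (fun i => k i y : K^o) l.
pose M := \sum_i rnorm re (e i).
pose B := [set b : 'rV[R]_(n + n) | `|b| <= M] `&`
  [set b | forall y, rnorm re (rcomb inj (g^~ y) b) <= rnorm re y].
exists (n + n)%N, g, B; split.
- move=> l a x y; rewrite /g /frame; case: fintype.split => i; rewrite kl //.
  by rewrite scalerDr !scalerA [w * a]mulrC -scalerA.
- apply: compact_closedI; first exact: rV_closed_ball_compact.
  rewrite (_ : [set b | _] = \bigcap_(y in setT)
    [set b | rnorm re (rcomb inj (g^~ y) b) <= rnorm re y]).
    apply: closed_bigI => y _; apply: closed_sublevel.
    exact: (rcomb_rnorm_continuous rf).
  by apply/seteqP; split => [b H y _|b H y]; exact: H.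
- by move=> b [].
- move=> ys lys ysn.
  have ysE y : ys y = rcomb inj (g^~ y) (frame_coord re im (fun i => ys (e i))).
    rewrite (frame_coordE rf) {1}[y]kE (linear_sumZ lys).
    by apply: eq_bigr => i _; exact: mulrC.
  exists (frame_coord re im (fun i => ys (e i))) => //; split => /=.
    apply: (frame_coord_le rf); first by apply: sumr_ge0 => i _; exact: (rnorm_ge0 rf).
    move=> i; apply: le_trans (ysn _) _; rewrite /M (bigD1 i) //= lerDl sumr_ge0 //.
    by move=> j _; exact: (rnorm_ge0 rf).
  by move=> y; rewrite -ysE.
Qed.

Context {X Y : normedModType K}.
Implicit Types (G S T : X -> Y).

Lemma linear_maps_span : findim X -> findim Y ->
  exists m (E : 'I_m -> X -> Y), (forall j, linear (E j)) /\
    forall T, linear T -> exists t, T = (fun x => rcomb inj (E^~ x) t).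
Proof.
move=> /findim_coord[n [e [k [kl kE]]]] /findim_coord[q [f [h [_ hE]]]].
pose I := ('I_n * 'I_(q + q))%type.
pose F (i : I) x : Y := k i.1 x *: frame w f i.2.
exists #|{: I}|, (fun j => F (enum_val j)); split.
  by move=> j a x y; rewrite /F kl scalerDl scalerA.
move=> T lT.
pose t (i : I) := frame_coord re im (h^~ (T (e i.1))) ord0 i.2.
exists (\row_j t (enum_val j)); apply/funext => x.
rewrite {1}[x]kE (linear_sumZ lT) /rcomb.
transitivity (\sum_(i : I) inj (t i) *: F i x); last first.
  rewrite (eq_bigl (mem {: I})) // big_enum_val.
  by apply: eq_bigr => j _; rewrite mxE.
rewrite -(pair_bigA _ (fun i l => inj (t (i, l)) *: F (i, l) x)) /=.
apply: eq_bigr => i _; rewrite {1}[T (e i)]hE -(frame_coordE rf) /rcomb scaler_sumr.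
by apply: eq_bigr => l _; rewrite /F !scalerA mulrC.
Qed.

Lemma linear_rcomb_maps m (E : 'I_m -> X -> Y) t :
  (forall j, linear (E j)) -> linear (fun x => rcomb inj (E^~ x) t).
Proof.
move=> lE a x y; rewrite /rcomb scaler_sumr -big_split; apply: eq_bigr => j _ /=.
by rewrite lE scalerDr !scalerA mulrC.
Qed.

Lemma linear_zero : linear ((fun=> 0) : X -> Y).
Proof. by move=> a x y; rewrite scaler0 addr0. Qed.

Section Functional.
Context {Phi : (X -> Y) -> K} (lPhi : lin_functional Phi).

Lemma lin_functional0 : Phi (fun=> 0) = 0.
Proof.
have := lPhi (-1) linear_zero linear_zero.
rewrite (_ : (fun x => _) = (fun=> 0)); first by rewrite mulN1r addNr.
by apply/funext => x; rewrite scaler0 addr0.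
Qed.

Lemma lin_functionalZ a T : linear T -> Phi (fun x => a *: T x) = a * Phi T.
Proof.
move=> lT; have := lPhi a lT linear_zero; rewrite lin_functional0 addr0 => <-.
by congr Phi; apply/funext => x; rewrite addr0.
Qed.

Lemma lin_functional_rcomb m (E : 'I_m -> X -> Y) t : (forall j, linear (E j)) ->
  Phi (fun x => rcomb inj (E^~ x) t) = \sum_j inj (t ord0 j) * Phi (E j).
Proof.
move=> lE; rewrite /rcomb.
(* Linearity of the partial sums is carried along, because [lin_functional] constrains [Phi] on
   linear maps only. *)
suff H (s : seq 'I_m) :
    linear (fun x => \sum_(j <- s) inj (t ord0 j) *: E j x) /\
    Phi (fun x => \sum_(j <- s) inj (t ord0 j) *: E j x) =
    \sum_(j <- s) inj (t ord0 j) * Phi (E j) by exact: (H _).2.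
elim: s => [|j s [ls IHs]].
  rewrite (_ : (fun x => _) = (fun=> 0)).
    by rewrite big_nil lin_functional0; split => //; exact: linear_zero.
  by apply/funext => x; rewrite big_nil.
rewrite (_ : (fun x => _) = (fun x => inj (t ord0 j) *: E j x +
    \sum_(j <- s) inj (t ord0 j) *: E j x)); last first.
  by apply/funext => x; rewrite big_cons.
split; last by rewrite lPhi // IHs big_cons.
move=> a x y; rewrite lE ls !scalerDr !scalerA [_ * a]mulrC.
by rewrite addrACA.
Qed.

End Functional.

(** This turns a functional into a point of R^m and its real part into a dot product, the form in
    which separation applies. *)
Lemma re_rcomb m (u : 'I_m -> K) (t : 'rV[R]_m) :
  re (\sum_j inj (t ord0 j) * u j) = dotr t (\row_j re (u j)).
Proof.
by rewrite (re_sum rf); apply: eq_bigr => j _; rewrite (rf_reZ rf) mxE.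
Qed.

Lemma dual_sphere_le (ys : Y -> K) : linear (ys : Y -> K^o) -> dual_sphere ys ->
  forall y, rnorm re (ys y) <= rnorm re y.
Proof.
move=> lys [ub _] y.
have [->|y0] := eqVneq y 0.
  by rewrite (linear_at0 lys) (@rnorm0 _ _ _ _ _ _ rf K^o) (rnorm_ge0 rf).
have ny0 : 0 < rnorm re y.
  rewrite lt_neqAle (rnorm_ge0 rf) andbT eq_sym.
  by apply: contra y0 => /eqP/(rnorm_eq0 rf) ->.
have /ub : [set `|ys x| | x in [set x : Y | `|x| <= 1]]
    `|ys (inj (rnorm re y)^-1 *: y)|.
  eexists; last by [].
  by rewrite /= -(inj_rnorm rf) (normalize rf) // rmorph1.
rewrite -(inj_rnorm rf) -(rmorph1 inj) (rf_le rf) (linear_scale lys).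
rewrite (@rnormZ _ _ _ _ _ _ rf K^o) (rnorm_inj rf) ger0_norm ?invr_ge0 ?(ltW ny0) //.
by rewrite ler_pdivrMl // mulr1.
Qed.

Lemma dual_sphere_attained (ys : Y -> K) y :
  (forall y, rnorm re (ys y) <= rnorm re y) ->
  rnorm re y = 1 -> 1 <= re (ys y) -> dual_sphere ys.
Proof.
move=> ysn y1 ysy; split => [_ [x /= x1 <-]|z ub].
  apply: le_trans x1; rewrite -!(inj_rnorm rf) (rf_le rf); exact: ysn.
apply: (@le_trans _ _ `|ys y|).
  rewrite -(inj_rnorm rf) -(rmorph1 inj) (rf_le rf); apply: le_trans ysy _.
  by apply: le_trans (ler_norm _) _; exact: (rf_re_norm rf).
apply: ub; exists y => //=.
by rewrite -(inj_rnorm rf) y1 rmorph1.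
Qed.

(* Only functionals attaining their norm at an explicit unit vector [y] are
   kept: quantifying over [y] makes the set a continuous image of a compact one,
   whereas the supremum in [dual_sphere] is not manifestly a closed condition. *)
Definition contact_coords G m (E : 'I_m -> X -> Y) : set 'rV[R]_m :=
  [set c | exists (x : X) (ys : Y -> K), [/\ rnorm re x = 1, rnorm re (G x) = 1,
     linear (ys : Y -> K^o) /\ (forall y, rnorm re (ys y) <= rnorm re y),
     exists2 y, rnorm re y = 1 & 1 <= re (ys y) &
     c = \row_j re (ys (E j x))]].

(** Three compact parameters run over x, y* and the vector y where y* attains its norm. The
    constraints are closed, with [1 <=] in place of equality since the norm bounds supply the
    reverse, and the coordinates are bilinear in the parameters. *)
Lemma contact_coords_compact G m (E : 'I_m -> X -> Y) :
  findim X -> findim Y -> linear G -> opnorm_eq1 G -> (forall j, linear (E j)) ->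
  compact (contact_coords G E).
Proof.
move=> fX fY lG oG lE.
have [N [u [A [cA sA]]]] := sphere_param rf fX.
have [Q [v [AY [cAY sAY]]]] := sphere_param rf fY.
have [P [g [B [lg cB Bn gB]]]] := dual_ball_param fY.
pose bil q (z : 'I_q -> Y) (b : 'rV[R]_P) (a : 'rV[R]_q) :=
  \sum_l \sum_j b ord0 l * a ord0 j * re (g l (z j)).
have bilE q (z : 'I_q -> Y) b a : re (rcomb inj (g^~ (rcomb inj z a)) b) = bil q z b a.
  rewrite /rcomb (re_sum rf); apply: eq_bigr => l _.
  rewrite [re _](rf_reZ rf) (linear_sumZ (lg l)) (re_sum rf) mulr_sumr.
  by apply: eq_bigr => j _; rewrite [re _](rf_reZ rf) mulrA.
pose A' := A `&` [set a | 1 <= rnorm re (rcomb inj (G \o u) a)].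
pose B' := (B `*` AY) `&` [set ba | 1 <= bil Q v ba.1 ba.2].
have cA' : compact A'.
  apply: compact_closedI => //; apply: closed_superlevel.
  exact: (rcomb_rnorm_continuous rf).
have cB' : compact B'.
  apply: compact_closedI; first exact: compact_setX.
  apply: closed_superlevel; apply: bilinear_continuous => x.
    exact: cvg_fst.
  exact: cvg_snd.
pose F (ab : 'rV[R]_N * ('rV[R]_P * 'rV[R]_Q)) : 'rV[R]_m :=
  \row_j bil N (E j \o u) ab.2.1 ab.1.
have cF : continuous F.
  apply: row_continuous => j; apply: bilinear_continuous => x; last exact: cvg_fst.
  apply: (@continuous_comp _ _ _ snd fst); [exact: cvg_snd|exact: cvg_fst].
have FE x b a : x = rcomb inj u a ->
    \row_j re (rcomb inj (g^~ (E j x)) b) = \row_j bil N (E j \o u) b a.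
  by move=> ->; apply/rowP => j; rewrite !mxE -bilE (linear_rcomb _ _ (lE j)).
rewrite (_ : contact_coords G E = F @` (A' `*` B')).
  apply: continuous_compact; last exact: compact_setX.
  exact: continuous_subspaceT.
apply/seteqP; split => [c [x [ys]]|].
  move=> [/sA[a Aa xE] Gx [lys ysn] [y /sAY[a' Aa' yE] ysy] ->].
  have [b Bb ysE] := gB _ lys ysn.
  exists (a, (b, a')); last first.
    rewrite /F /= -(FE x) //; apply/rowP => j; by rewrite !mxE ysE.
  split; split => //=.
    by rewrite -(linear_rcomb _ _ lG) -xE Gx.
  by rewrite -bilE -yE -ysE.
move=> _ [[a [b a']] [[/= Aa Ga] [[Bb Aa'] /= bil1]] <-].
have xn : rnorm re (rcomb inj u a) = 1 by apply/sA; exists a.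
exists (rcomb inj u a), (fun y => rcomb inj (g^~ y) b); split => //.
- apply/le_anti; rewrite (opnorm_eq1_le rf oG) ?xn //=.
  by rewrite (linear_rcomb _ _ lG).
- split; last exact: Bn.
  move=> c x y; rewrite /rcomb scaler_sumr -big_split; apply: eq_bigr => j _ /=.
  by rewrite lg scalerDr !scalerA mulrC.
- exists (rcomb inj v a'); first by apply/sAY; exists a'.
  by rewrite bilE.
- by rewrite /F /= -(FE _ _ _ erefl).
Qed.

(** Rescaling by the inverse of [a] reaches the unit ball. When [a] is 0, definiteness of the G-norm
    gives T = 0. *)
Lemma Gdual_ball_le G Phi T : Gnorm_is_norm G -> Gdual_ball G Phi ->
  linear T -> forall a, 0 <= a -> Gnorm G T = inj a -> rnorm re (Phi T) <= a.
Proof.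
move=> [_ Gdef GZ _] [lPhi Phi1] lT a; rewrite le_eqVlt => /orP[/eqP<-|a0] GT.
  have T0 := Gdef _ lT; rewrite (_ : T = fun=> 0).
    by rewrite (lin_functional0 lPhi) (@rnorm0 _ _ _ _ _ _ rf K^o).
  by apply/funext => x; rewrite T0 // GT rmorph0.
have lS : linear (fun x => inj a^-1 *: T x).
  by move=> c x y; rewrite lT scalerDr !scalerA mulrC.
have GS : Gnorm G (fun x => inj a^-1 *: T x) = 1.
  rewrite GZ // GT -(inj_rnorm rf) (rnorm_inj rf) ger0_norm ?invr_ge0 ?(ltW a0) //.
  by rewrite -rmorphM mulVf ?gt_eqF // rmorph1.
have := Phi1 _ lS; rewrite GS => /(_ (lexx _)).
rewrite (lin_functionalZ lPhi) // -(inj_rnorm rf) -(rmorph1 inj) (rf_le rf).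
rewrite (@rnormZ _ _ _ _ _ _ rf K^o) (rnorm_inj rf) ger0_norm ?invr_ge0 ?(ltW a0) //.
by rewrite ler_pdivrMl // mulr1.
Qed.

Lemma Gdual_ball_sub_co G Phi : findim X -> findim Y -> linear G ->
  opnorm_eq1 G -> Gnorm_is_norm G -> Gdual_ball G Phi -> co_Ctilde G Phi.
Proof.
move=> fX fY lG oG nG bPhi; have [lPhi _] := bPhi.
have [m [E [lE spanE]]] := linear_maps_span fX fY.
have cC := contact_coords_compact fX fY lG oG lE.
have lcomb t := linear_rcomb_maps t lE.
have rePhi t : re (Phi (fun x => rcomb inj (E^~ x) t)) =
    dotr t (\row_j re (Phi (E j))).
  by rewrite (lin_functional_rcomb lPhi) // re_rcomb.
have repsi t x (ys : Y -> K) : linear (ys : Y -> K^o) ->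
    re (ys (rcomb inj (E^~ x) t)) = dotr t (\row_j re (ys (E j x))).
  by move=> lys; rewrite (linear_sumZ lys) -re_rcomb.
have sep v : exists2 c, contact_coords G E c &
    dotr v (\row_j re (Phi (E j))) <= dotr v c.
  have [x0 [x01 Gx0 GT _]] := Gnorm_attained rf fX lG oG (lcomb v).
  set T := (fun x => rcomb inj (E^~ x) v) in GT.
  have PhiT := Gdual_ball_le nG bPhi (lcomb v) (rnorm_ge0 rf _) GT.
  have [ys [lys ysn [y y1 ysy] ysT]] : exists ys : Y -> K,
      [/\ linear (ys : Y -> K^o), forall y, rnorm re (ys y) <= rnorm re y,
        exists2 y, rnorm re y = 1 & 1 <= re (ys y) &
        re (ys (T x0)) = rnorm re (T x0)].
    (* If T x0 = 0, any functional gives the value 0, but it must still attain norm 1 somewhere; one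
       norming the unit vector [G x0] does. *)
    have [Tx0|Tx0] := eqVneq (T x0) 0.
      have [ys [lys ysn ysG]] := hahn_banach rf (G x0) fY.
      exists ys; split => //; first by exists (G x0); rewrite // ysG Gx0.
      by rewrite Tx0 (rnorm0 rf) (linear_at0 lys); exact: (re0 rf).
    have [ys [lys ysn ysT]] := hahn_banach rf (T x0) fY.
    exists ys; split => //.
    exists (inj (rnorm re (T x0))^-1 *: T x0); first exact: (normalize rf).
    rewrite (linear_scale lys) [re _](rf_reZ rf) ysT mulVf //.
    by apply: contra Tx0 => /eqP/(rnorm_eq0 rf) ->.
  exists (\row_j re (ys (E j x0))); first by exists x0, ys; split => //; exists y.
  rewrite -rePhi -repsi // -/(T x0) ysT; apply: le_trans PhiT.
  exact: le_trans (ler_norm _) (rf_re_norm rf _).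
have [l [c [l0 l1 Cc pE]]] := hull_separation cC sep.
have /choice[xy xyP] : forall i, exists xy : X * (Y -> K),
    [/\ rnorm re xy.1 = 1, rnorm re (G xy.1) = 1,
     linear (xy.2 : Y -> K^o) /\ (forall y, rnorm re (xy.2 y) <= rnorm re y),
     exists2 y, rnorm re y = 1 & 1 <= re (xy.2 y) &
     c i = \row_j re (xy.2 (E j xy.1))].
  by move=> i; have [x [ys H]] := Cc i; exists (x, ys).
exists m.+1, (fun i => inj (l i)), (fun i => psi (xy i).1 (xy i).2); split.
- by move=> i; rewrite -(rmorph0 inj) (rf_le rf).
- by rewrite -rmorph_sum l1 rmorph1.
- move=> i; have [x1 Gx1 [lys ysn] [y y1 ysy] _] := xyP i.
  exists (xy i).1, (xy i).2; split => //.
  + by rewrite -(rmorph1 inj); apply/(rnorm_eq rf).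
  + exact: dual_sphere_attained y1 ysy.
  + by rewrite -(rmorph1 inj); apply/(rnorm_eq rf).
have reE T : linear T ->
    re (Phi T) = re (\sum_i inj (l i) * psi (xy i).1 (xy i).2 T).
  move=> /spanE[t ->]; rewrite rePhi pE (re_sum rf).
  rewrite (big_morph (dotr t) (dotrDr t) (_ : dotr t 0 = 0)); last first.
    by apply: big1 => j _; rewrite mxE mulr0.
  apply: eq_bigr => i _; rewrite dotrZr (rf_reZ rf) /psi.
  by have [_ _ [lys _] _ ->] := xyP i; rewrite repsi.
move=> T lT; apply/eqP; rewrite -subr_eq0; apply/eqP.
(* Agreement of real parts is known for every linear map; applied to z T for all scalars z, it gives
   agreement in [K]. *)
apply: (re_separates rf) => z.
have lzT : linear (fun x => z *: T x).
  by move=> a x y; rewrite lT scalerDr !scalerA mulrC.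
rewrite mulrBr -(lin_functionalZ lPhi) // (rf_reD rf) reE // -(rf_reD rf).
rewrite mulr_sumr -sumrB big1 ?(re0 rf) // => i _.
have [_ _ [lys _] _ _] := xyP i.
by rewrite /psi (linear_scale lys) mulrCA subrr.
Qed.

(** Each psi is bounded at T by |T x| for some x with |x| = |G x| = 1, hence by the maximum that
    equals the G-norm; convex weights preserve this. *)
Lemma co_sub_Gdual_ball G Phi : findim X -> linear G ->
  opnorm_eq1 G -> co_Ctilde G Phi -> Gdual_ball G Phi.
Proof.
move=> fX lG oG [n [l [c [l0 l1 Cc PhiE]]]]; split.
  move=> a S T lS lT.
  have lST : linear (fun x => a *: S x + T x).
    by move=> b x y; rewrite lS lT !scalerDr !scalerA [a * b]mulrC addrACA.
  rewrite !PhiE // mulr_sumr -big_split; apply: eq_bigr => i _ /=.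
  have [x [ys [_ lys _ _ cE]]] := Cc i.
  by rewrite !cE // /psi lys mulrDr mulrCA.
move=> T lT GT; have [x0 [_ _ GE Tmax]] := Gnorm_attained rf fX lG oG lT.
rewrite PhiE //; apply: le_trans (ler_norm_sum _ _ _) _.
rewrite -l1; apply: ler_sum => i _; rewrite normrM (ger0_norm (l0 i)).
rewrite ler_piMr //; apply: le_trans GT; rewrite GE.
have [x [ys [x1 lys dys Gx cE]]] := Cc i.
rewrite cE // /psi -(inj_rnorm rf) (rf_le rf).
apply: le_trans (dual_sphere_le lys dys _) (Tmax _ _ _).
  by apply/(rnorm_eq rf); rewrite rmorph1.
by apply/(rnorm_eq rf); rewrite rmorph1.
Qed.

End Main.

(** * The real and complex scalar fields *)

Lemma real_form_real (R : realType) :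
  real_form (idfun : {rmorphism R -> R}) idfun (fun=> 0) 0.
Proof.
split => //= [z|z|h _ hZ].
- by rewrite normr0.
- by rewrite mul0r addr0.
- by exists (h 1) => z; rewrite -[z in LHS]mulr1 hZ mulrC.
Qed.

Lemma real_form_complex (R : realType) :
  real_form (real_complex R : {rmorphism R -> R[i]})
    (@complex.Re R) (@complex.Im R) 'i%C.
Proof.
split.
- exact: lecR.
- by move=> z z0; apply: RRe_real; exact: ger0_real.
- by case=> a b [c d].
- by move=> a [b c] /=; rewrite mul0r subr0.
- by move=> z; rewrite -lecR RRe_real ?normr_real // normc_ge_Re.
- move=> z; rewrite -lecR RRe_real ?normr_real //.
  (* Multiplication by i preserves the modulus and moves the imaginary part to the real part, up to
     sign. *)
  have := normc_ge_Re (z * 'i%C); rewrite ReiNIm normrN normrM.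
  by rewrite [`|'i%C|]normc_def /= expr0n add0r expr1n sqrtr1 mulr1.
- by move=> z; rewrite {1}[z]complexE mulrC.
(* Real linearity gives h(a + b i) = a h(1) + b h(i), which is the real part of (h(1) - i h(i)) (a +
   b i). *)
- move=> h hD hZ; exists (Complex (h 1) (- h 'i%C)) => -[a b] /=.
  rewrite [X in h X](complexE (Complex a b)) /= ['i%C * _]mulrC hD hZ.
  rewrite -[a%:C%C]mulr1 hZ; ring.
Qed.

(* K = R (first conjunct) and K = C = R[i] (second conjunct). *)
Theorem theorem3p9 (R : realType) :
  (forall (X Y : completeNormedModType R) (G : X -> Y),
     findim X -> findim Y -> linear G -> opnorm_eq1 G -> Gnorm_is_norm G ->
     forall Phi : (X -> Y) -> R, Gdual_ball G Phi <-> co_Ctilde G Phi) /\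
  (forall (X Y : completeNormedModType R[i]) (G : X -> Y),
     findim X -> findim Y -> linear G -> opnorm_eq1 G -> Gnorm_is_norm G ->
     forall Phi : (X -> Y) -> R[i], Gdual_ball G Phi <-> co_Ctilde G Phi).
Proof.
split=> X Y G fX fY lG oG nG Phi; split.
- exact: (Gdual_ball_sub_co (real_form_real R)).
- exact: (co_sub_Gdual_ball (real_form_real R)).
- exact: (Gdual_ball_sub_co (real_form_complex R)).
- exact: (co_sub_Gdual_ball (real_form_complex R)).
Qed.
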